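(* Let $M,N,k$ be positive integers with $k\le N$, and let $\mathbf{B}_1,\dots,\mathbf{B}_M\in\mathbb{R}^{N\times N}$. Let $\mathbf{U}$ (together with $\{\mathbf{V}_m\}_{m=1}^M$) be the optimal solution to the minimization problem $$\min_{\substack{\mathbf{U},\,\{\mathbf{V}_m\}_{m=1}^M\in\mathbb{R}^{N\times k}\\ \mathbf{U}^T\mathbf{U}=\mathbf{I}_k}}\ \sum_{m=1}^M\Vert \mathbf{B}_m-\mathbf{U}\mathbf{V}_m^T\Vert_F^2 .$$ Then $\mathbf{U}$ consists of the $k$ eigenvectors of the matrix $$\mathbf{N}=\sum_{m=1}^M\mathbf{B}_m\mathbf{B}_m^T$$ corresponding to the first $k$ dominant (i.e. $k$ largest) eigenvalues; that is, the columns of $\mathbf{U}$ are these eigenvectors.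
   Context: $\Vert\cdot\Vert_F$ is the Frobenius norm and $\mathbf{I}_k$ is the $k\times k$ identity matrix. The orthonormality constraint is imposed on $\mathbf{U}$ only; the matrices $\mathbf{V}_m$ are unconstrained. The reduced dimension is $k=\lceil\theta N\rceil$ for a pre-specified data compression ratio $\theta\in[0,1]$. The bold matrix $\mathbf{N}$ is symmetric and is distinct from the integer $N$ (the dimension).
   Formalization: An optimal U has eigenvector columns only up to a rotation (U,V_m)→(UQ,V_mQ), Q orthogonal (fails e.g. for M=1, N=k=2, B_1=diag(1,0), U a 45° rotation). Proved: for every optimal U some UQ consists of the k dominant eigenvectors; conversely any such eigenvectors form an optimal U. *)

(* Defs.v *)
From HB Require Import structures.
From mathcomp Require Import all_boot all_order all_algebra all_fingroup.
From mathcomp Require Import reals.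
Set Implicit Arguments.
Unset Strict Implicit.
Unset Printing Implicit Defensive.
Import Order.TTheory GRing.Theory Num.Theory.
Local Open Scope ring_scope.

(* The norm that the library puts on matrices is the max norm, hence this
   definition. *)
Definition frobenius_norm (R : realType) (m n : nat) (A : 'M[R]_(m, n)) : R :=
  Num.sqrt (\sum_i \sum_j A i j ^+ 2).

Definition orthonormal_cols (R : realType) (n k : nat) (U : 'M[R]_(n, k)) :
  Prop := U^T *m U = 1%:M.

Definition objective (R : realType) (M N k : nat) (B : 'I_M -> 'M[R]_N)
    (U : 'M[R]_(N, k)) (V : 'I_M -> 'M[R]_(N, k)) : R :=
  \sum_(m < M) frobenius_norm (B m - U *m (V m)^T) ^+ 2.

Definition optimal_solution (R : realType) (M N k : nat)
    (B : 'I_M -> 'M[R]_N)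
    (U : 'M[R]_(N, k)) (V : 'I_M -> 'M[R]_(N, k)) : Prop :=
  orthonormal_cols U /\
  forall (U' : 'M[R]_(N, k)) (V' : 'I_M -> 'M[R]_(N, k)),
    orthonormal_cols U' -> objective B U V <= objective B U' V'.

Definition gram_sum (R : realType) (M N : nat) (B : 'I_M -> 'M[R]_N) :
  'M[R]_N := \sum_(m < M) B m *m (B m)^T.

(* Column eigenvectors; the library's [eigenspace] is about row vectors. *)
Definition is_eigenvector (R : realType) (n : nat) (A : 'M[R]_n) (a : R)
    (v : 'cV[R]_n) : Prop :=
  v != 0 /\ A *m v = a *: v.

(* [lam] lists all the eigenvalues of [A], repeated according to their
   multiplicity, in nonincreasing order. *)
Definition sorted_spectrum (R : realType) (n : nat) (A : 'M[R]_n)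
    (lam : n.-tuple R) : Prop :=
  char_poly A = \prod_(a <- lam) ('X - a%:P) /\ sorted (>=%R) lam.

(* Column [j] of [U] is an eigenvector for the eigenvalue of rank [sigma j];
   the permutation leaves the order of the columns free. Orthonormality makes
   the columns independent when an eigenvalue is repeated. *)
Definition dominant_eigenvectors (R : realType) (n k : nat) (A : 'M[R]_n)
    (U : 'M[R]_(n, k)) : Prop :=
  orthonormal_cols U /\
  exists (lam : n.-tuple R) (sigma : 'S_k),
    sorted_spectrum A lam /\
    forall j : 'I_k, is_eigenvector A (nth 0 lam (sigma j)) (col j U).

(* Main.v *)
Require Import Defs.
From HB Require Import structures.
From mathcomp Require Import all_boot all_order all_algebra all_fingroup.
From mathcomp Require Import reals ring lra complex.
Set Implicit Arguments.
Unset Strict Implicit.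
Unset Printing Implicit Defensive.
Import Order.TTheory GRing.Theory Num.Theory.
Local Open Scope ring_scope.

(** For U with orthonormal columns, completing the square in each V_m gives
    (objective_decomposition)
      objective B U V = sum_m ||B_m||^2 - tr (U^T N U)
                        + sum_m ||V_m - B_m^T U||^2,   N = sum_m B_m B_m^T.
    So (U, V) can be optimal only if U maximizes tr (U^T N U) among the
    matrices with orthonormal columns (optimal_max_trace), and each such U is
    optimal together with V_m = B_m^T U (max_trace_optimal). What remains is a
    statement about a symmetric matrix A = N: up to a rotation of the columns,
    the maximizers of tr (U^T A U) are the systems of k dominant eigenvectors.

    Maximizers are dominant (max_trace_dominant). Complete U to an orthonormal
    basis by a matrix W. Rotating one column u of U towards one column w of W
    cannot increase the trace; at first order this says w^T A u = 0, at second
    order w^T A w <= u^T A u (max_trace_saddle). Hence A leaves the column space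
    of U and that of W invariant. Diagonalizing A on each of the two spaces,
    with decreasing eigenvalues s on the first and t on the second, gives every
    s_i >= every t_j, so that the concatenation s ++ t is already the sorted
    spectrum of A, and the rotated columns of U belong to its first k entries.

    Dominant eigenvectors are maximizers (dominant_max_trace). This is the
    inequality of Ky Fan: in an orthonormal eigenbasis of A, the trace
    tr (U^T A U) is a combination sum_i lam_i w_i of the eigenvalues with weights
    in [0, 1] of total mass k, hence at most the sum of the k largest ones
    (ky_fan), a value that dominant eigenvectors attain.

    Both halves rest on the real spectral theorem (spectral_theorem) and on the
    completion of orthonormal columns (orthonormal_completion). *)

(** * Real eigenvalues of symmetric matrices *)

(** Over R[i] the matrix is Hermitian, so the complex spectral theorem gives it a
    real eigenvalue; being a root of the characteristic polynomial, it is an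
    eigenvalue over R as well. *)
Lemma symmetric_eigenvalue (R : rcfType) (n : nat) (A : 'M[R]_n.+1) :
  A^T = A -> exists a, eigenvalue A a.
Proof.
move=> symA; pose f := real_complex R; pose AC : 'M[R[i]]_n.+1 := map_mx f A.
have AC_herm : AC \is hermsymmx.
  apply/is_hermitianmxP; rewrite expr0 scale1r; apply/matrixP=> i j.
  by rewrite !mxE -[in LHS]symA mxE /= /f; apply/esym/conjc_real.
have /hermitian_normalmx /orthomx_spectralP AC_eq := AC_herm.
have /mxOverP/(_ 0 0) := hermitian_spectral_diag_real AC_herm.
move=> /complex_realP[a def_a]; exists a.
have : eigenvalue AC (f a).
  apply/eigenvalueP; exists (row 0 (spectralmx AC)).
    rewrite -row_mul [in X in row 0 (_ *m X)]AC_eq !mulmxA.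
    rewrite mulmxV ?spectral_unit // mul1mx.
    by apply/rowP=> j; rewrite mxE mul_diag_mx !mxE def_a.
  have := spectral_unit AC; rewrite -row_free_unit => /row_freeP[B PB].
  apply/eqP=> row0; have /matrixP/(_ 0 0)/eqP := PB.
  have -> : (spectralmx AC *m B) 0 0 = (row 0 (spectralmx AC) *m B) 0 0.
    by rewrite -row_mul [RHS]mxE.
  by rewrite row0 mul0mx !mxE eqxx eq_sym oner_eq0.
rewrite !eigenvalue_root_char -map_char_poly fmorph_root //.
Qed.

(** * Orthonormal columns and their completion *)

(** H is the reflection in the hyperplane orthogonal to w = v - e, which exchanges
    v and e because both have length one. Definiteness of the scalar product
    makes w^T w = 0 the degenerate case v = e. *)
Lemma householder (R : fieldType) (n : nat) (v e : 'cV[R]_n) :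
  (forall w : 'cV[R]_n, w^T *m w = 0 -> w = 0) ->
  v^T *m v = 1%:M -> e^T *m e = 1%:M ->
  exists H : 'M[R]_n, H^T *m H = 1%:M /\ H *m v = e.
Proof.
move=> definite vv ee; pose w := v - e; pose c := 1 - (e^T *m v) 0 0.
have ev : e^T *m v = (1 - c)%:M by rewrite [LHS]mx11_scalar opprB addrC subrK.
have ve : v^T *m e = (1 - c)%:M by rewrite -[LHS]trmxK trmx_mul trmxK ev tr_scalar_mx.
have wT : w^T = v^T - e^T by rewrite /w linearB.
have ww : w^T *m w = (c + c)%:M.
  rewrite wT mulmxBl !mulmxBr vv ee ev ve -!raddfB /=.
  by congr (_%:M); ring.
have wv : w^T *m v = c%:M.
  by rewrite wT mulmxBl vv ev -raddfB /=; congr (_%:M); ring.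
have [c0|c0] := eqVneq c 0.
  exists 1%:M; rewrite trmx1 !mul1mx; split=> //.
  by apply/eqP; rewrite -subr_eq0; apply/eqP/definite; rewrite ww c0 addr0 raddf0.
exists (1%:M - c^-1 *: (w *m w^T)).
rewrite [X in X *m _]linearB /= linearZ /= trmx_mul trmxK trmx1; split; last first.
  rewrite mulmxBl mul1mx -scalemxAl -mulmxA wv mul_mx_scalar scalerA mulVf //.
  by rewrite scale1r /w opprB addrC subrK.
rewrite mulmxBl !mulmxBr !mul1mx mulmx1 -scalemxAl -scalemxAr.
rewrite mulmxA -(mulmxA w) ww mul_mx_scalar -scalemxAl !scalerA.
rewrite (_ : c^-1 * (c^-1 * _) = c^-1 + c^-1); last by field.
by rewrite scalerDl; apply/matrixP=> i j; rewrite !mxE; ring.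
Qed.

Lemma mulTmx_diag (R : nzRingType) (m n : nat) (A : 'M[R]_(m, n)) (j : 'I_n) :
  (A^T *m A) j j = \sum_i A i j * A i j.
Proof. by rewrite mxE; apply: eq_bigr => i _; rewrite mxE. Qed.

Lemma mulTmx_eq0 (R : realDomainType) (m n : nat) (A : 'M[R]_(m, n)) :
  A^T *m A = 0 -> A = 0.
Proof.
move=> AA0; apply/matrixP=> i j; have /matrixP/(_ j j) := AA0.
rewrite mulTmx_diag [RHS]mxE => /eqP.
rewrite psumr_eq0 => [/allP/(_ i)|i' _]; last by rewrite -expr2 sqr_ge0.
by rewrite mem_index_enum mxE mulf_eq0 orbb => /(_ isT)/eqP.
Qed.

Lemma orthonormal_row_mx (R : realType) (n k l : nat)
    (U : 'M[R]_(n, k)) (W : 'M[R]_(n, l)) :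
  orthonormal_cols (row_mx U W) <->
  [/\ orthonormal_cols U, U^T *m W = 0 & orthonormal_cols W].
Proof.
rewrite /orthonormal_cols tr_row_mx mul_col_row scalar_mx_block; split.
  by case/eq_block_mx.
case=> -> UW ->; rewrite UW; congr block_mx.
by rewrite -[LHS]trmxK trmx_mul trmxK UW trmx0.
Qed.

Lemma orthonormal_mul (R : realType) (m n k : nat)
    (H : 'M[R]_(m, n)) (U : 'M[R]_(n, k)) :
  orthonormal_cols H -> orthonormal_cols U -> orthonormal_cols (H *m U).
Proof.
rewrite /orthonormal_cols => HH UU.
by rewrite trmx_mul mulmxA -(mulmxA U^T) HH mulmx1.
Qed.

Lemma orthonormal_square (R : realType) (n : nat) (P : 'M[R]_n) :
  orthonormal_cols P -> P *m P^T = 1%:M.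
Proof. exact: mulmx1C. Qed.

(** Induction on k: a reflection H sends the first column to the first basis vector
    e; orthogonality to e then forces the other columns of H U to have a zero
    first entry, and deleting it leaves k - 1 orthonormal columns in dimension
    one less. A completion of these is carried back by H^T. *)
Lemma orthonormal_completion (R : realType) (k l : nat) (U : 'M[R]_(k + l, k)) :
  orthonormal_cols U ->
  exists W : 'M[R]_(k + l, l), orthonormal_cols (row_mx U W).
Proof.
elim: k => [|k IHk] in U *.
  exists 1%:M; apply/orthonormal_row_mx; split=> //.
  - by apply/matrixP; case.
  - by rewrite /orthonormal_cols trmx1 mulmx1.
pose V : 'M[R]_(1 + (k + l), 1 + k) := U => UU.
(* The first basis vector, in the block form used for V. *)
pose e : 'cV[R]_(1 + (k + l)) := col_mx 1%:M 0.
have ee : e^T *m e = 1%:M.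
  by rewrite tr_col_mx mul_row_col trmx1 trmx0 mulmx1 mulmx0 addr0.
have /orthonormal_row_mx[uu uU' U'U'] : orthonormal_cols (row_mx (lsubmx V) (rsubmx V)).
  by rewrite hsubmxK.
have [H [HH Hu]] := householder (@mulTmx_eq0 _ _ _) uu ee.
have HH' := orthonormal_square HH.
have /orthonormal_row_mx[_ eHU' HU'HU'] : orthonormal_cols (row_mx e (H *m rsubmx V)).
  rewrite -Hu -mul_mx_row hsubmxK; exact: orthonormal_mul.
pose U1 := dsubmx (H *m rsubmx V).
have HU'E : H *m rsubmx V = col_mx 0 U1.
  rewrite -[LHS]vsubmxK; congr col_mx.
  by move: eHU'; rewrite -{1}[H *m _]vsubmxK /e tr_col_mx mul_row_col trmx1 trmx0
     mul1mx mul0mx addr0.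
have U1U1 : orthonormal_cols U1.
  by move: HU'HU'; rewrite /orthonormal_cols HU'E tr_col_mx mul_row_col mulmx0 add0r.
have [W1 /orthonormal_row_mx[_ UW1 W1W1]] := IHk U1 U1U1.
exists (H^T *m col_mx 0 W1).
apply/(@orthonormal_row_mx R (1 + (k + l)) (1 + k)); split=> //.
- have -> : U = H^T *m row_mx e (col_mx 0 U1).
    by rewrite -HU'E -Hu -mul_mx_row hsubmxK mulmxA HH mul1mx.
  rewrite trmx_mul trmxK -mulmxA (mulmxA H) HH' mul1mx.
  rewrite tr_row_mx mul_col_mx /e !tr_col_mx !mul_row_col !mulmx0 trmx0 mul0mx.
  by rewrite !add0r UW1 col_mx0.
- apply: orthonormal_mul; first by rewrite /orthonormal_cols trmxK.
  by rewrite /orthonormal_cols tr_col_mx mul_row_col mulmx0 add0r.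
Qed.

(** * The spectral theorem for real symmetric matrices *)

(** Induction by deflation: complete a unit eigenvector u to an orthonormal basis
    [u W]; as u is an eigenvector and A is symmetric, A is block diagonal in this
    basis, and the induction hypothesis applies to W^T A W. *)
Lemma spectral_theorem (R : realType) (n : nat) (A : 'M[R]_n) :
  A^T = A ->
  exists (P : 'M[R]_n) (d : 'rV[R]_n),
    orthonormal_cols P /\ P^T *m A *m P = diag_mx d.
Proof.
elim: n => [|n IHn] in A * => symA.
  by exists 1%:M, 0; split; apply/matrixP; case.
have [a /eigenvalueP[v vA v0]] := symmetric_eigenvalue symA.
pose c := (Num.sqrt ((v *m v^T) 0 0))^-1; pose u : 'cV[R]_(1 + n) := c *: v^T.
have uT : u^T = c *: v by rewrite /u linearZ /= trmxK.
have Au : A *m u = a *: u.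
  rewrite -scalemxAr -[A *m _]trmxK trmx_mul trmxK symA vA linearZ /=.
  by rewrite !scalerA mulrC.
have uu : orthonormal_cols u.
  rewrite /orthonormal_cols uT -scalemxAl -scalemxAr scalerA.
  rewrite [v *m _]mx11_scalar scale_scalar_mx; congr (_%:M).
  have vv : (v *m v^T) 0 0 = \sum_i v 0 i * v 0 i.
    by rewrite -[v in v *m _]trmxK mulTmx_diag; apply: eq_bigr => i _; rewrite mxE.
  rewrite -expr2 exprVn sqr_sqrtr.
    rewrite mulVf //; apply: contraNneq v0 => vv0.
    rewrite -[v]trmxK (mulTmx_eq0 (A := v^T)) ?trmx0 // trmxK.
    by rewrite [LHS]mx11_scalar vv0 raddf0.
  by rewrite vv sumr_ge0 // => i _; rewrite -expr2 sqr_ge0.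
have [W /orthonormal_row_mx[_ uW WW]] := orthonormal_completion uu.
have [|P1 [d1 [P1P1 P1d1]]] := IHn (W^T *m A *m W).
  by rewrite !trmx_mul trmxK symA mulmxA.
pose P : 'M[R]_(1 + n) := row_mx u (W *m P1).
pose A' : 'M[R]_(1 + n) := A.
suff PAP : P^T *m A' *m P = diag_mx (row_mx a%:M d1).
  exists P, (row_mx a%:M d1); split=> //.
  apply/(@orthonormal_row_mx R (1 + n) 1 n); split=> //; last exact: orthonormal_mul.
  by rewrite mulmxA uW mul0mx.
have Wu : W^T *m u = 0 by rewrite -[LHS]trmxK trmx_mul trmxK uW trmx0.
have uA : u^T *m A' = a *: u^T.
  by rewrite -[LHS]trmxK trmx_mul trmxK symA Au linearZ.
rewrite tr_row_mx mul_col_mx mul_col_row diag_mx_row uA -scalemxAl uu scalemx1.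
rewrite -!scalemxAl !mulmxA uW mul0mx scaler0 trmx_mul -/A'  -!mulmxA Au -scalemxAr.
rewrite Wu scaler0 mulmx0 !mulmxA -(mulmxA P1^T) -(mulmxA P1^T) P1d1.
congr block_mx; apply/matrixP=> i j; rewrite !ord1 !mxE //.
Qed.

Lemma char_poly_orthonormal_diag (R : realType) (n : nat) (A P : 'M[R]_n)
    (d : 'rV[R]_n) :
  orthonormal_cols P -> P^T *m A *m P = diag_mx d ->
  char_poly A = \prod_i ('X - (d 0 i)%:P).
Proof.
move=> PP PAP; transitivity (char_poly (diag_mx d)); last first.
  rewrite char_poly_trig ?diag_mx_is_trig //.
  by apply: eq_bigr => i _; rewrite mxE eqxx.
rewrite -PAP /char_poly; set P' := map_mx polyC P.
have P'P' : P'^T *m P' = 1%:M by rewrite map_trmx -map_mxM PP map_mx1.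
have -> : char_poly_mx (P^T *m A *m P) = P'^T *m char_poly_mx A *m P'.
  rewrite /char_poly_mx mulmxBr mulmxBl mul_mx_scalar -scalemxAl P'P' scalemx1.
  by rewrite !map_mxM -map_trmx.
by rewrite !det_mulmx mulrAC -det_mulmx P'P' det1 mul1r.
Qed.

(** The diagonal entries can be put in any order, by permuting the columns of P. *)
Lemma orthonormal_diag_perm (R : realType) (n : nat) (A P : 'M[R]_n)
    (d : 'rV[R]_n) (lam : n.-tuple R) :
  orthonormal_cols P -> P^T *m A *m P = diag_mx d ->
  perm_eq lam [tuple d 0 i | i < n] ->
  exists Q : 'M[R]_n, orthonormal_cols Q /\
    Q^T *m A *m Q = diag_mx (\row_i tnth lam i).
Proof.
move=> PP PAP /tuple_permP[s lamE].
have permE B : (col_perm s P)^T *m B *m col_perm s P =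
    \matrix_(i, j) (P^T *m B *m P) (s i) (s j).
  apply/matrixP=> i j; rewrite !mxE; apply: eq_bigr => a _; rewrite !mxE.
  by congr (_ * _); apply: eq_bigr => b _; rewrite !mxE.
exists (col_perm s P); rewrite permE /orthonormal_cols.
rewrite -[(col_perm s P)^T]mulmx1 permE mulmx1 PP PAP; split; apply/matrixP=> i j.
  by rewrite !mxE (inj_eq perm_inj).
rewrite !mxE (inj_eq perm_inj).
by congr (_ *+ _); rewrite (tnth_nth 0) lamE -tnth_nth !tnth_mktuple.
Qed.

(** A factorization of the characteristic polynomial into linear factors is
    unique up to order, hence any listing of the spectrum can serve as the
    diagonal. *)
Lemma spectral_theorem_of_spectrum (R : realType) (n : nat) (A : 'M[R]_n)
    (lam : n.-tuple R) :
  A^T = A -> char_poly A = \prod_(a <- lam) ('X - a%:P) ->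
  exists P : 'M[R]_n, orthonormal_cols P /\
    P^T *m A *m P = diag_mx (\row_i tnth lam i).
Proof.
move=> /spectral_theorem[P [d [PP PAP]]] charA.
apply: (orthonormal_diag_perm PP PAP); apply: prod_XsubC_eq; rewrite -charA.
by rewrite (char_poly_orthonormal_diag PP PAP) big_tuple; apply: eq_bigr => i _;
  rewrite tnth_mktuple.
Qed.

Lemma spectral_theorem_sorted (R : realType) (n : nat) (A : 'M[R]_n) :
  A^T = A ->
  exists (P : 'M[R]_n) (lam : n.-tuple R),
    [/\ orthonormal_cols P, sorted (>=%R) lam
      & P^T *m A *m P = diag_mx (\row_i tnth lam i)].
Proof.
move=> /spectral_theorem[P [d [PP PAP]]].
pose lam := [tuple of sort (>=%R) [tuple d 0 i | i < n]].
have /(orthonormal_diag_perm PP PAP)[Q [QQ QAQ]] : perm_eq lam [tuple d 0 i | i < n].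
  by rewrite perm_sort.
exists Q, lam; split=> //; apply: sort_sorted => x y; exact: le_total.
Qed.

(** * Ky Fan's inequality *)

(** Subtracting the threshold c from all the values turns the claim into two
    termwise bounds: over I the weights are at most 1 against values d - c >= 0,
    over J they are nonnegative against values d - c <= 0. The mass #|I| of the
    weights makes the shift by c cancel. *)
Lemma sum_dominated_weights (R : realDomainType) (I J : finType)
    (d w : I + J -> R) (c : R) :
  (forall i, c <= d (inl i)) -> (forall j, d (inr j) <= c) ->
  (forall x, 0 <= w x <= 1) -> \sum_x w x = #|I|%:R ->
  \sum_x d x * w x <= \sum_i d (inl i).
Proof.
move=> d_ge d_le w01; rewrite !big_sumType /= => sum_w.
have le1 : \sum_i (d (inl i) - c) * w (inl i) <= \sum_i (d (inl i) - c).
  apply: ler_sum => i _; have /andP[w0 w1] := w01 (inl i).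
  by rewrite ler_piMr // subr_ge0.
have le2 : \sum_j (d (inr j) - c) * w (inr j) <= 0.
  apply: sumr_le0 => j _; have /andP[w0 w1] := w01 (inr j).
  by rewrite mulr_le0_ge0 // subr_le0.
rewrite sumrB sumr_const -mulr_natr -sum_w in le1.
have E (K : finType) (f g : K -> R) :
    \sum_i (f i - c) * g i = \sum_i f i * g i - c * \sum_i g i.
  by rewrite mulr_sumr -sumrB; apply: eq_bigr => i _; rewrite mulrBl.
rewrite !E mulrDr in le1 le2; lra.
Qed.

(** The entry is the squared norm of row i of U, hence nonnegative; so is the
    corresponding entry of the complementary projection 1 - U U^T, since a
    symmetric idempotent E satisfies E = E^T E. *)
Lemma orthonormal_row_norm (R : realType) (n k : nat) (U : 'M[R]_(n, k)) i :
  orthonormal_cols U -> 0 <= (U *m U^T) i i <= 1.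
Proof.
move=> UU; have sq m (A : 'M[R]_(m, n)) : 0 <= (A^T *m A) i i.
  by rewrite mulTmx_diag sumr_ge0 // => j _; rewrite -expr2 sqr_ge0.
have:= sq _ (U^T); rewrite trmxK => -> /=.
pose E := 1%:M - U *m U^T.
have EE : E^T *m E = E.
  have -> : E^T = E by rewrite /E linearB /= trmx1 trmx_mul trmxK.
  rewrite {1}/E mulmxBl mul1mx /E mulmxBr mulmx1 -mulmxA (mulmxA U^T) UU mul1mx.
  by rewrite subrr subr0.
by have := sq _ E; rewrite EE !mxE eqxx subr_ge0.
Qed.

(** The weight of the eigenvalue d_x is the diagonal entry of U U^T at x, and
    these entries add up to tr (U U^T) = tr (U^T U) = k. *)
Lemma ky_fan (R : realType) (k l : nat) (d : 'rV[R]_(k + l)) (c : R)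
    (U : 'M[R]_(k + l, k)) :
  (forall i, c <= d 0 (lshift l i)) -> (forall j, d 0 (rshift k j) <= c) ->
  orthonormal_cols U ->
  \tr (U^T *m diag_mx d *m U) <= \sum_i d 0 (lshift l i).
Proof.
move=> d_ge d_le UU; pose w x := (U *m U^T) (unsplit x) (unsplit x).
have -> : \tr (U^T *m diag_mx d *m U) =
    \sum_(x : 'I_k + 'I_l) d 0 (unsplit x) * w x.
  rewrite mxtrace_mulC mulmxA mxtrace_mulC /mxtrace big_split_ord big_sumType /=.
  by congr (_ + _); apply: eq_bigr => i _; rewrite mul_diag_mx mxE.
apply: (@sum_dominated_weights _ _ _ (fun x => d 0 (unsplit x)) w c) => //.
  by move=> x; apply: orthonormal_row_norm.
have := congr1 mxtrace UU; rewrite mxtrace_mulC mxtrace1 card_ord => <-.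
by rewrite /mxtrace big_split_ord big_sumType.
Qed.

(** * From the objective to a trace *)

Lemma frobenius_norm_sqr (R : realType) (m n : nat) (A : 'M[R]_(m, n)) :
  frobenius_norm A ^+ 2 = \tr (A^T *m A).
Proof.
rewrite sqr_sqrtr.
  rewrite exchange_big; apply: eq_bigr => j _; rewrite mulTmx_diag.
  by apply: eq_bigr => i _; rewrite expr2.
by apply: sumr_ge0 => i _; apply: sumr_ge0 => j _; rewrite sqr_ge0.
Qed.

(** Completing the square: for fixed U the best V is A^T U. *)
Lemma frobenius_residual (R : realType) (m n k : nat) (A : 'M[R]_(m, n))
    (U : 'M[R]_(m, k)) (V : 'M[R]_(n, k)) :
  orthonormal_cols U ->
  frobenius_norm (A - U *m V^T) ^+ 2 =
    frobenius_norm A ^+ 2 - \tr (U^T *m (A *m A^T) *m U)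
    + frobenius_norm (V - A^T *m U) ^+ 2.
Proof.
move=> UU; rewrite !frobenius_norm_sqr.
have trB p q (X Y : 'M[R]_(p, q)) : (X - Y)^T = X^T - Y^T by rewrite linearB.
rewrite !trB !mulmxBl !mulmxBr !trmx_mul !trmxK !raddfB /=.
rewrite -!mulmxA (mulmxA U^T U) UU mul1mx.
rewrite [\tr (V *m V^T)]mxtrace_mulC [\tr (V *m (U^T *m A))]mxtrace_mulC.
have -> : \tr (A^T *m (U *m V^T)) = \tr (V^T *m (A^T *m U)).
  by rewrite mulmxA mxtrace_mulC.
rewrite -!mulmxA; ring.
Qed.

Lemma objective_decomposition (R : realType) (M N k : nat) (B : 'I_M -> 'M[R]_N)
    (U : 'M[R]_(N, k)) (V : 'I_M -> 'M[R]_(N, k)) :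
  orthonormal_cols U ->
  objective B U V =
    \sum_m frobenius_norm (B m) ^+ 2 - \tr (U^T *m gram_sum B *m U)
    + \sum_m frobenius_norm (V m - (B m)^T *m U) ^+ 2.
Proof.
move=> UU; rewrite /gram_sum mulmx_sumr mulmx_suml (raddf_sum mxtrace).
rewrite /= -sumrB -big_split.
by apply: eq_bigr => m _; apply: frobenius_residual.
Qed.

Definition max_trace (R : realType) (n k : nat) (A : 'M[R]_n)
    (U : 'M[R]_(n, k)) : Prop :=
  forall U' : 'M[R]_(n, k), orthonormal_cols U' ->
    \tr (U'^T *m A *m U') <= \tr (U^T *m A *m U).

(** Comparing (U, V) with the pair made of U' and its best V'_m = B_m^T U'. *)
Lemma optimal_max_trace (R : realType) (M N k : nat) (B : 'I_M -> 'M[R]_N)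
    (U : 'M[R]_(N, k)) (V : 'I_M -> 'M[R]_(N, k)) :
  optimal_solution B U V -> max_trace (gram_sum B) U.
Proof.
case=> UU opt U' UU'; have := opt U' (fun m => (B m)^T *m U') UU'.
rewrite !objective_decomposition // [X in _ <= _ + X]big1 => [|m _].
  have : 0 <= \sum_m frobenius_norm (V m - (B m)^T *m U) ^+ 2.
    by apply: sumr_ge0 => m _; rewrite sqr_ge0.
  lra.
by rewrite subrr frobenius_norm_sqr mulmx0 mxtrace0.
Qed.

Lemma max_trace_optimal (R : realType) (M N k : nat) (B : 'I_M -> 'M[R]_N)
    (U : 'M[R]_(N, k)) :
  orthonormal_cols U -> max_trace (gram_sum B) U ->
  optimal_solution B U (fun m => (B m)^T *m U).
Proof.
move=> UU maxU; split=> // U' V' UU'; have := maxU U' UU'.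
rewrite !objective_decomposition // [X in _ + X <= _]big1 => [|m _].
  have : 0 <= \sum_m frobenius_norm (V' m - (B m)^T *m U') ^+ 2.
    by apply: sumr_ge0 => m _; rewrite sqr_ge0.
  lra.
by rewrite subrr frobenius_norm_sqr mulmx0 mxtrace0.
Qed.

Lemma max_trace_mul_orthonormal (R : realType) (n k : nat) (A : 'M[R]_n)
    (U : 'M[R]_(n, k)) (Q : 'M[R]_k) :
  orthonormal_cols Q -> max_trace A U -> max_trace A (U *m Q).
Proof.
move=> QQ maxU U' UU'; have -> : \tr ((U *m Q)^T *m A *m (U *m Q)) =
    \tr (U^T *m A *m U).
  rewrite trmx_mul -!mulmxA mxtrace_mulC -!mulmxA.
  by rewrite orthonormal_square // mulmx1.
exact: maxU.
Qed.

Lemma optimal_solution_mul_orthonormal (R : realType) (M N k : nat)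
    (B : 'I_M -> 'M[R]_N) (U : 'M[R]_(N, k)) (V : 'I_M -> 'M[R]_(N, k))
    (Q : 'M[R]_k) :
  orthonormal_cols Q -> optimal_solution B U V ->
  optimal_solution B (U *m Q) (fun m => V m *m Q).
Proof.
move=> QQ [UU opt]; split; first exact: orthonormal_mul.
suff -> : objective B (U *m Q) (fun m => V m *m Q) = objective B U V by [].
apply: eq_bigr => m _.
by rewrite trmx_mul mulmxA -(mulmxA U) orthonormal_square // mulmx1.
Qed.

(** * Maximizers of the trace *)

(** The inequality compares U with the matrix U' obtained by replacing the
    column u = U_i by the unit vector (p u + q w) / sqrt (p^2 + q^2), where w = W_j:
    the two traces differ only in the i-th diagonal entry. It is stated in the
    homogeneous variables p and q so that no square root is left. *)
Lemma max_trace_rotation (R : realType) (n k l : nat) (A : 'M[R]_n)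
    (U : 'M[R]_(n, k)) (W : 'M[R]_(n, l)) (i : 'I_k) (j : 'I_l) (p q : R) :
  A^T = A -> orthonormal_cols (row_mx U W) -> max_trace A U ->
  p ^+ 2 * (U^T *m A *m U) i i + 2 * p * q * (W^T *m A *m U) j i
    + q ^+ 2 * (W^T *m A *m W) j j
  <= (p ^+ 2 + q ^+ 2) * (U^T *m A *m U) i i.
Proof.
move=> symA /orthonormal_row_mx[UU UW WW] maxU.
have [r0|r_neq0] := eqVneq (p ^+ 2 + q ^+ 2) 0.
  have /andP[/eqP p0 /eqP q0] : (p == 0) && (q == 0).
    by rewrite -(sqrf_eq0 p) -(sqrf_eq0 q) -paddr_eq0 ?sqr_ge0 // r0.
  by rewrite p0 q0 !(expr2, mulr0, mul0r, addr0).
pose r := Num.sqrt (p ^+ 2 + q ^+ 2).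
have r2 : r ^+ 2 = p ^+ 2 + q ^+ 2 by rewrite sqr_sqrtr // addr_ge0 ?sqr_ge0.
have r0 : r != 0 by rewrite -sqrf_eq0 r2.
pose c := p / r; pose s := q / r.
have cs : c ^+ 2 + s ^+ 2 = 1.
  by rewrite !expr_div_n -mulrDl r2 divff.
(* U' = U D + s W T scales column i of U by c and adds s w to it. *)
pose D : 'rV[R]_k := \row_a (if a == i then c else 1).
pose T := delta_mx j i : 'M[R]_(l, k).
pose U' := U *m diag_mx D + s *: (W *m T).
have WU : W^T *m U = 0 by rewrite -[LHS]trmxK trmx_mul trmxK UW trmx0.
have U'T : U'^T = diag_mx D *m U^T + s *: (T^T *m W^T).
  by rewrite /U' linearD linearZ /= !trmx_mul tr_diag_mx.
have TT : T^T *m T = delta_mx i i by rewrite trmx_delta mul_delta_mx.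
have U'U' : orthonormal_cols U'.
  rewrite /orthonormal_cols U'T /U' mulmxDl !mulmxDr -!scalemxAl -!scalemxAr.
  rewrite -!mulmxA (mulmxA U^T) UU (mulmxA U^T) UW (mulmxA W^T) WU (mulmxA W^T) WW.
  rewrite !(mul0mx, mulmx0, scaler0) add0r addr0 !mul1mx TT scalerA mulmx_diag.
  apply/matrixP=> a b; rewrite !mxE.
  have [->|] := eqVneq a b; last first.
    case: (eqVneq a i) => [<-|] ab; rewrite ?andbF /= ?mulr0 ?addr0 //.
    by rewrite eq_sym (negPf ab) mulr0 addr0.
  by case: eqVneq => _; rewrite ?mulr1 ?mulr0 ?addr0 // mulr1n -!expr2.
have := maxU U' U'U'.
set S := U^T *m A *m U; set C := W^T *m A *m U; set E := W^T *m A *m W.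
have CT : U^T *m A *m W = C^T by rewrite /C !trmx_mul trmxK symA mulmxA.
have U'AU' : U'^T *m A *m U' = diag_mx D *m S *m diag_mx D
    + s *: (diag_mx D *m C^T *m T) + s *: (T^T *m C *m diag_mx D)
    + s ^+ 2 *: (T^T *m E *m T).
  rewrite U'T /U' !mulmxDl !mulmxDr -CT /S /C /E -!scalemxAl -!scalemxAr.
  by rewrite scalerA !mulmxA addrA.
rewrite U'AU' !mxtraceD !mxtraceZ; clear U'AU' CT; clearbody S C E.
have tr_delta (X : 'M[R]_(l, k)) : \tr (T^T *m X) = X j i.
  rewrite /T trmx_delta /mxtrace (bigD1 i) //= big1 => [|a ai].
    rewrite mxE (bigD1 j) //= big1 => [|b bj]; first by rewrite !mxE !eqxx mul1r !addr0.
    by rewrite !mxE (negPf bj) andbF mul0r.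
  by rewrite mxE big1 // => b _; rewrite !mxE (negPf ai) mul0r.
have -> : \tr (diag_mx D *m C^T *m T) = c * C j i.
  rewrite -mxtrace_tr trmx_mul trmx_mul trmxK tr_diag_mx tr_delta.
  by rewrite mul_mx_diag !mxE eqxx mulrC.
have -> : \tr (T^T *m C *m diag_mx D) = c * C j i.
  by rewrite -mulmxA tr_delta mul_mx_diag !mxE eqxx mulrC.
have -> : \tr (T^T *m E *m T) = E j j.
  rewrite -mulmxA tr_delta /T mxE (bigD1 j) //= big1 => [|b bj].
    by rewrite mxE !eqxx mulr1 addr0.
  by rewrite mxE (negPf bj) mulr0.
have -> : \tr (diag_mx D *m S *m diag_mx D) = \tr S + (c ^+ 2 - 1) * S i i.
  have DSD x : (diag_mx D *m S *m diag_mx D) x x = D 0 x * S x x * D 0 x.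
    by rewrite mul_mx_diag mul_diag_mx !mxE.
  rewrite /mxtrace (eq_bigr _ (fun x _ => DSD x)) !(bigD1 i (P := xpredT)) //=.
  rewrite (eq_bigr (fun x => S x x)) => [|x /negPf xi]; last first.
    by rewrite mxE xi mul1r mulr1.
  by rewrite mxE eqxx; ring.
have pE : p = r * c by rewrite /c mulrC divfK.
have qE : q = r * s by rewrite /s mulrC divfK.
(* The claim for p = c and q = s, that is, for unit vectors. *)
move=> le; have {}le : c ^+ 2 * S i i + 2 * c * s * C j i + s ^+ 2 * E j j <= S i i.
  by lra.
rewrite -r2; have := ler_wpM2l (sqr_ge0 r) le; rewrite pE qE.
by congr (_ <= _); ring.
Qed.

(** With b = w^T A u, the rotation inequality says that the quadratic form
    q^2 (w^T A w - u^T A u) + 2 p q b is never positive. This forces its pure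
    coefficient to be nonpositive and its mixed coefficient b to vanish. *)
Lemma max_trace_saddle (R : realType) (n k l : nat) (A : 'M[R]_n)
    (U : 'M[R]_(n, k)) (W : 'M[R]_(n, l)) :
  A^T = A -> orthonormal_cols (row_mx U W) -> max_trace A U ->
  W^T *m A *m U = 0 /\
  forall i j, (W^T *m A *m W) j j <= (U^T *m A *m U) i i.
Proof.
move=> symA UW maxU; have rot i j p q := max_trace_rotation i j p q symA UW maxU.
have le i j : (W^T *m A *m W) j j <= (U^T *m A *m U) i i.
  have := rot i j 0 1; lra.
split=> //; apply/matrixP=> j i; rewrite [RHS]mxE.
set b := (W^T *m A *m U) j i.
(* The quadratic form at p = a - d + 1 and q = b, where a = u^T A u and
   d = w^T A w, is b^2 (a - d + 2), whose last factor is positive. *)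
have := rot i j ((U^T *m A *m U) i i - (W^T *m A *m W) j j + 1) b.
have := le i j; rewrite -/b; set a := (U^T *m A *m U) i i.
set d := (W^T *m A *m W) j j => le_da le_rot.
apply/eqP; rewrite -sqrf_eq0 eq_le sqr_ge0 andbT.
rewrite -(pmulr_rle0 _ (x := a - d + 2)); last by lra.
nra.
Qed.

(** The two diagonal blocks U^T A U and W^T A W are diagonalized separately;
    max_trace_saddle, applied to the rotated columns, says both that the
    off-diagonal blocks vanish and that the two spectra are already in order. *)
Lemma max_trace_dominant (R : realType) (k l : nat) (A : 'M[R]_(k + l))
    (U : 'M[R]_(k + l, k)) :
  A^T = A -> orthonormal_cols U -> max_trace A U ->
  exists Q : 'M[R]_k,
    orthonormal_cols Q /\ dominant_eigenvectors A (U *m Q).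
Proof.
move=> symA UU maxU.
have symX m (X : 'M[R]_(k + l, m)) : (X^T *m A *m X)^T = X^T *m A *m X.
  by rewrite !trmx_mul trmxK symA mulmxA.
have [Q [s [QQ s_sorted QSQ]]] := spectral_theorem_sorted (symX _ U).
have [W /orthonormal_row_mx[_ UW WW]] := orthonormal_completion UU.
have [P [t [PP t_sorted PTP]]] := spectral_theorem_sorted (symX _ W).
pose U1 := U *m Q; pose W1 := W *m P.
have U1AU1 : U1^T *m A *m U1 = diag_mx (\row_i tnth s i).
  by rewrite -QSQ /U1 trmx_mul !mulmxA.
have W1AW1 : W1^T *m A *m W1 = diag_mx (\row_i tnth t i).
  by rewrite -PTP /W1 trmx_mul !mulmxA.
have U1U1 : orthonormal_cols U1 by exact: orthonormal_mul.
have UW1 : orthonormal_cols (row_mx U1 W1).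
  apply/orthonormal_row_mx; split=> //; last exact: orthonormal_mul.
  by rewrite /U1 /W1 trmx_mul mulmxA -(mulmxA Q^T) UW mulmx0 mul0mx.
have [WAU ts] := max_trace_saddle symA UW1 (max_trace_mul_orthonormal QQ maxU).
have AU1 : A *m U1 = U1 *m diag_mx (\row_i tnth s i).
  rewrite -[LHS]mul1mx -(orthonormal_square UW1) tr_row_mx -mulmxA mul_col_mx.
  by rewrite (mulmxA U1^T) (mulmxA W1^T) U1AU1 WAU mul_row_col mulmx0 addr0.
exists Q; split=> //; split=> //.
(* The columns of U Q come in decreasing order: no permutation is needed. *)
exists [tuple of s ++ t], 1%g; split; first split.
- have PAP : (row_mx U1 W1)^T *m A *m row_mx U1 W1 =
      diag_mx (row_mx (\row_i tnth s i) (\row_i tnth t i)).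
    have UAW : U1^T *m A *m W1 = (W1^T *m A *m U1)^T.
      by rewrite [RHS]trmx_mul (trmx_mul W1^T) trmxK symA mulmxA.
    rewrite tr_row_mx mul_col_mx mul_col_row U1AU1 W1AW1 UAW WAU trmx0.
    by rewrite diag_mx_row.
  rewrite (char_poly_orthonormal_diag UW1 PAP) big_split_ord big_cat !big_tuple /=.
  by congr (_ * _); apply: eq_bigr => i _; rewrite ?row_mxEl ?row_mxEr mxE.
- rewrite (sorted_pairwise ge_trans) pairwise_cat -!(sorted_pairwise ge_trans).
  rewrite s_sorted t_sorted !andbT; apply/allrelP => x y /tnthP[i ->] /tnthP[j ->].
  by have := ts i j; rewrite U1AU1 W1AW1 !mxE !eqxx.
- move=> j; split.
    apply/eqP=> u0; have /matrixP/(_ j j)/eqP := U1U1.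
    rewrite mulTmx_diag big1 ?mxE ?eqxx ?(eq_sym 0) ?oner_eq0 // => i _.
    by have /colP/(_ i) := u0; rewrite !mxE => ->; rewrite mul0r.
  rewrite perm1 nth_cat size_tuple ltn_ord -tnth_nth -/U1 colE mulmxA AU1 -!colE.
  by apply/colP=> i; rewrite mul_mx_diag !mxE mulrC.
Qed.

(** The trace for U is the sum of the k largest eigenvalues, which is the bound that
    ky_fan gives for every competitor once A is diagonalized. *)
Lemma dominant_max_trace (R : realType) (k l : nat) (A : 'M[R]_(k + l))
    (U : 'M[R]_(k + l, k)) :
  (0 < k)%N -> A^T = A -> dominant_eigenvectors A U -> max_trace A U.
Proof.
move=> k_gt0 symA [UU [lam [sigma [[charA lam_sorted] eigU]]]] U' U'U'.
have [P [PP PAP]] := spectral_theorem_of_spectrum symA charA.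
have PP' := orthonormal_square PP.
pose D : 'rV[R]_(k + l) := \row_i tnth lam i.
have lamE i : D 0 i = nth 0 lam i by rewrite mxE (tnth_nth 0).
have lam_anti i j : (i <= j < k + l)%N -> nth 0 lam j <= nth 0 lam i.
  case/andP=> ij j_lt.
  by apply: (sorted_leq_nth ge_trans ge_refl) => //; rewrite inE size_tuple //;
    apply: leq_ltn_trans j_lt.
have -> : \tr (U^T *m A *m U) = \sum_(i < k) D 0 (lshift l i).
  rewrite [RHS](reindex_inj (@perm_inj _ sigma)); apply: eq_bigr => j _.
  have [_ Auj] := eigU j.
  rewrite lamE /= -mulmxA.
  have -> : (U^T *m (A *m U)) j j = (U^T *m (A *m col j U)) j 0.
    by rewrite colE !mulmxA -colE [RHS]mxE.
  by rewrite Auj -scalemxAr colE mulmxA UU -colE !mxE eqxx mulr1.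
have -> : U'^T *m A *m U' = (P^T *m U')^T *m diag_mx D *m (P^T *m U').
  rewrite -PAP trmx_mul trmxK !mulmxA -(mulmxA U'^T P) PP' mulmx1.
  by rewrite -(mulmxA _ P) PP' mulmx1.
(* The threshold is the k-th largest eigenvalue. *)
apply: (ky_fan (c := nth 0 lam k.-1)).
- move=> i; rewrite lamE; apply: lam_anti => /=.
  by rewrite -ltnS prednK // ltn_ord (leq_trans _ (leq_addr l k)) // prednK.
- move=> j; rewrite lamE; apply: lam_anti => /=.
  by rewrite (leq_trans (leq_pred k)) ?leq_addr ?ltn_add2l ?ltn_ord.
- by apply: orthonormal_mul => //; rewrite /orthonormal_cols trmxK.
Qed.

(** * Optimal solutions and dominant eigenvectors *)

Lemma gram_sum_sym (R : realType) (M N : nat) (B : 'I_M -> 'M[R]_N) :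
  (gram_sum B)^T = gram_sum B.
Proof.
by rewrite /gram_sum raddf_sum; apply: eq_bigr => m _; rewrite /= trmx_mul trmxK.
Qed.

(* Replacing (U, V_m) by (U Q, V_m Q) with Q orthogonal changes neither the
   constraint nor the objective, so an optimal U is determined at best up to
   such a Q. *)
Theorem theorem4p3 (R : realType) (M N k : nat)
    (M_gt0 : (0 < M)%N) (N_gt0 : (0 < N)%N) (k_gt0 : (0 < k)%N)
    (k_le_N : (k <= N)%N) (B : 'I_M -> 'M[R]_N) :
  (forall (U : 'M[R]_(N, k)) (V : 'I_M -> 'M[R]_(N, k)),
     optimal_solution B U V ->
     exists Q : 'M[R]_k,
       [/\ Q^T *m Q = 1%:M,
           optimal_solution B (U *m Q) (fun m => V m *m Q)
         & dominant_eigenvectors (gram_sum B) (U *m Q)]) /\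
  (forall U : 'M[R]_(N, k),
     dominant_eigenvectors (gram_sum B) U ->
     exists V : 'I_M -> 'M[R]_(N, k), optimal_solution B U V).
Proof.
have [l defN] : exists l, N = (k + l)%N by exists (N - k)%N; rewrite subnKC.
subst N; have symN := gram_sum_sym B; split=> [U V optUV | U domU].
  have maxU := optimal_max_trace optUV.
  have [Q [QQ domUQ]] := max_trace_dominant symN (proj1 optUV) maxU.
  by exists Q; split=> //; apply: optimal_solution_mul_orthonormal.
exists (fun m => (B m)^T *m U); apply: max_trace_optimal; first by case: domU.
exact: dominant_max_trace.
Qed.
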